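(* Fix real $a$, $b>0$, $c>0$ and a prior $F$ with support $[\alpha,\beta]\subset(0,c)$ and mean $M_1$. Let $\mathcal S$ be the set of symmetric information structures in which each player privately observes a signal about his own type only, the same signal rule being applied to both players and signals being independent across players conditional on the type profile. For $\pi\in\mathcal S$, let $\hat\theta_\pi=E[\theta\mid s_\pi]$ be a player's posterior-mean cost; posterior means are i.i.d. across players. The affine benchmark induced by $\pi$ is the unique symmetric Bayesian Nash equilibrium of the affine relaxation of the contest in which each player's type is his posterior-mean cost (distributed as $\hat\theta_\pi$); when $\hat\theta_\pi$ is degenerate, its expected effort is defined by continuity as the limit of the expected effort as the variance of the posterior-mean distribution tends to $0$ with the mean fixed. Let $\mathcal E(\pi)$ denote the ex ante expected effort in the affine benchmark induced by $\pi$. Then $\mathcal E(\pi)$ depends on $\pi$ only through $\operatorname{Var}(\hat\theta_\pi)$. Consequently, a designer maximizing $\mathcal E$ over $\mathcal S$ chooses no disclosure (the uninformative signal) if $a>0$, full disclosure (signal revealing the type) if $a<0$, and is indifferent among all signals in $\mathcal S$ if $a=0$. Equivalently, if $\pi$ is more Blackwell-informative than $\pi'$, then $\mathcal E(\pi)\le\mathcal E(\pi')$ when $a>0$ and $\mathcal E(\pi)\ge\mathcal E(\pi')$ when $a<0$.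
   Context: The contest: two players with cost types; a type-$\theta$ player choosing effort $\tilde x$ against opponent strategy $x(\cdot)$ receives expected payoff $E[P(\tilde x,x(\text{opponent's type}))]-\theta\tilde x$, where $P(x,y)=\tfrac12+(x-y)\bigl(c-b(x+y)+axy\bigr)$. Because payoffs are linear in the cost, a player informed by a signal evaluates payoffs using his posterior-mean cost. The affine relaxation allows actions in $\mathbb R$ and uses the raw, untruncated $P$; for $a=0$ each type $\hat\theta$ plays the dominant strategy $(c-\hat\theta)/(2b)$. *)

(* Defs.v *)
From HB Require Import structures.
From mathcomp Require Import all_boot all_order all_algebra.
From mathcomp Require Import all_classical all_reals all_analysis.
Set Implicit Arguments. Unset Strict Implicit. Unset Printing Implicit Defensive.
Import Order.TTheory GRing.Theory Num.Theory.
Import numFieldNormedType.Exports.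
Local Open Scope classical_set_scope.
Local Open Scope ring_scope.

Section contest.
Variable R : realType.

(* Raw (untruncated) win probability of effort x against effort y. *)
Definition Pwin (a b c x y : R) : R :=
  1 / 2 + (x - y) * (c - b * (x + y) + a * x * y).

(* An "expectation operator" over the type of a (generic) opponent:
   E h = E[h(type)], in the extended reals. *)
Definition expectation := (R -> R) -> \bar R.

Definition EG (G : probability R R) : expectation :=
  fun h => (\int[G]_t (h t)%:E)%E.

(* expectation of h(posterior mean) when types are drawn from F, signals
   from the kernel pi, and m is the posterior-mean map signal -> E[theta|s]. *)
Definition Epi d (S : measurableType d) (F : probability R R)
  (pi : R.-pker R ~> S) (m : S -> R) : expectation :=
  fun h => (\int[F]_th \int[pi th]_s (h (m s))%:E)%E.

Definition mean_of (E : expectation) : R := fine (E id).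
Definition var_of (E : expectation) : R :=
  fine (E (fun t => t ^+ 2)) - (fine (E id)) ^+ 2.

(* Symmetric Bayesian Nash equilibrium of the affine relaxation (actions in R,
   raw P) when both players' types are i.i.d. with expectation operator E:
   every type t in R best responds (over all real efforts z) to the opponent
   playing x. *)
Definition sym_BNE (a b c : R) (E : expectation) (x : R -> R) : Prop :=
  [/\ measurable_fun [set: R] x,
      (E (fun t => `|x t|%R) < +oo)%E,
      (E (fun t => (x t ^+ 2)%R) < +oo)%E &
      forall t z : R,
        (E (fun t' => Pwin a b c z (x t')) - (t * z)%R%:E <=
         E (fun t' => Pwin a b c (x t) (x t')) - (t * x t)%R%:E)%E].

Definition eq_effort (a b c : R) (E : expectation) (e : R) : Prop :=
  exists x, sym_BNE a b c E x /\ e = fine (E x).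

Definition limit_effort (a b c mu e : R) : Prop :=
  forall (G : nat -> probability R R) (en : nat -> R),
    (forall n, (\int[G n]_t `|t|%:E < +oo)%E /\
               (\int[G n]_t (t ^+ 2)%R%:E < +oo)%E /\
               mean_of (EG (G n)) = mu /\
               0 < var_of (EG (G n)) /\
               eq_effort a b c (EG (G n)) (en n)) ->
    (fun n => var_of (EG (G n))) @ \oo --> (0 : R) ->
    en @ \oo --> e.

Definition bench_effort (a b c : R) (E : expectation) (e : R) : Prop :=
  (0 < var_of E /\ eq_effort a b c E e) \/
  (var_of E = 0 /\ limit_effort a b c (mean_of E) e).

Definition post_mean d (S : measurableType d) (F : probability R R)
  (pi : R.-pker R ~> S) (m : S -> R) : Prop :=
  [/\ measurable_fun [set: S] m,
      (\int[F]_th \int[pi th]_s `|m s|%R%:E < +oo)%E &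
      forall B, measurable B ->
        (\int[F]_th (th%:E * pi th B) =
         \int[F]_th \int[pi th]_(s in B) (m s)%:E)%E].

Definition post_var d (S : measurableType d) (F : probability R R)
  (pi : R.-pker R ~> S) (v : R) : Prop :=
  forall m, post_mean F pi m -> var_of (Epi F pi m) = v.

Definition effort d (S : measurableType d) (a b c : R) (F : probability R R)
  (pi : R.-pker R ~> S) (e : R) : Prop :=
  (exists m, post_mean F pi m) /\
  forall m, post_mean F pi m -> bench_effort a b c (Epi F pi m) e.

Definition more_informative d d' (S : measurableType d) (S' : measurableType d')
  (pi : R.-pker R ~> S) (pi' : R.-pker R ~> S') : Prop :=
  exists g : R.-pker S ~> S', forall th B, measurable B ->
    pi' th B = (\int[pi th]_s g s B)%E.

Definition no_disclosure : R.-pker R ~> unit :=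
  kdirac (@measurable_cst _ _ R unit [set: R] tt).

Definition full_disclosure : R.-pker R ~> R :=
  kdirac (@measurable_id _ R [set: R]).

Definition has_support (F : probability R R) (al be : R) : Prop :=
  F `[al, be]%classic = 1%E /\
  forall t, al <= t <= be -> forall eps : R, 0 < eps -> (0 < F `](t - eps)%R, (t + eps)%R[%classic)%E.

End contest.

(* Main.v *)
(** In an equilibrium against opponents with mean effort [A] and second moment
[B], a player's payoff is a quadratic in his own effort with curvature
[D = b - a A], so every type plays [(c - a B - t) / (2 D)] and [D > 0].  Taking
moments, [D ^ 2] solves [y (y - L) = a ^ 2 v / 4] with [L = b ^ 2 - a (c - mu)],
where [mu] and [v] are the mean and variance of the types.  This equation has a
single positive root, increasing in [v]; hence [A = (b - D) / a] is determined
by [mu] and [v], decreasing in [v] when [a > 0] and increasing when [a < 0].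

If the signal [s'] is a garbling of [s], then the posterior means [m], [m']
satisfy [E m' ^ 2 = E (theta m') = E (m m') <= (E m ^ 2 + E m' ^ 2) / 2], so
[Var m' <= Var m].  No disclosure is a garbling of every signal and every signal
is a garbling of full disclosure. *)
Require Import Defs.
From HB Require Import structures.
From mathcomp Require Import all_boot all_order all_algebra.
From mathcomp Require Import all_classical all_reals all_analysis.
From mathcomp Require Import measurable_realfun finmap ring lra.
Set Implicit Arguments. Unset Strict Implicit. Unset Printing Implicit Defensive.
Import Order.TTheory GRing.Theory Num.Theory.
Import numFieldNormedType.Exports.
Local Open Scope classical_set_scope.
Local Open Scope ring_scope.

(** * The equilibrium equation *)

Section Equilibrium_algebra.
Variable R : realType.
Implicit Types a b c v : R.

(** The larger root of [y * (y - L) = K]. The two roots have product [- K], so for [K > 0] it is the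
    only positive one. *)
Definition margin_sq (L K : R) : R := (L + Num.sqrt (L ^+ 2 + 4 * K)) / 2.

Lemma margin_sqE L K : 0 <= K ->
  margin_sq L K * (margin_sq L K - L) = K.
Proof.
move=> K0; have h : 0 <= L ^+ 2 + 4 * K by have := sqr_ge0 L; lra.
have := sqr_sqrtr h; rewrite /margin_sq; set s := Num.sqrt _ => hs.
have -> : (L + s) / 2 * ((L + s) / 2 - L) = (s ^+ 2 - L ^+ 2) / 4 by field.
by rewrite hs; field.
Qed.

Lemma margin_sq_ge L K : 0 <= K -> L <= margin_sq L K.
Proof.
move=> K0; have h : `|L| <= Num.sqrt (L ^+ 2 + 4 * K).
  by rewrite -sqrtr_sqr ler_wsqrtr //; lra.
by have := ler_norm L; rewrite /margin_sq; lra.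
Qed.

Lemma margin_sq_ge0 L K : 0 <= K -> 0 <= margin_sq L K.
Proof.
move=> K0; have h : `|L| <= Num.sqrt (L ^+ 2 + 4 * K).
  by rewrite -sqrtr_sqr ler_wsqrtr //; lra.
by have := ler_norm (- L); rewrite normrN /margin_sq; lra.
Qed.

Lemma margin_sq_gt0 L K : 0 < K -> 0 < margin_sq L K.
Proof.
move=> K0; rewrite lt_neqAle margin_sq_ge0 ?ltW // andbT.
apply/eqP => y0; have := margin_sqE L (ltW K0); rewrite -y0; lra.
Qed.

Lemma margin_sq_le L K K' : 0 <= K -> K <= K' -> margin_sq L K <= margin_sq L K'.
Proof.
move=> K0 KK'; have : Num.sqrt (L ^+ 2 + 4 * K) <= Num.sqrt (L ^+ 2 + 4 * K').
  by rewrite ler_wsqrtr //; lra.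
by rewrite /margin_sq; lra.
Qed.

(** For two candidates [y] and [z], the values differ by [(z - y) * (z + y - L)], and the second
    factor is positive because [L <= z] and [0 < y]. *)
Lemma margin_sq_uniq L K y : 0 <= K -> 0 < y -> y * (y - L) = K ->
  y = margin_sq L K.
Proof.
move=> K0 y0 hy; have hz := margin_sqE L K0.
have z0 := margin_sq_ge0 L K0; have zL := margin_sq_ge L K0.
set z := margin_sq L K in hz z0 zL *.
have yL : L <= y by rewrite -subr_ge0 -(pmulr_rge0 _ y0) hy.
case: (ltgtP y z) => // yz; exfalso.
- suff : y * (y - L) < z * (z - L) by rewrite hy hz ltxx.
  have : 0 < (z - y) * (z + y - L) by apply: mulr_gt0; lra.
  lra.
- suff : z * (z - L) < y * (y - L) by rewrite hy hz ltxx.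
  have : 0 < (y - z) * (z + y - L) by apply: mulr_gt0; lra.
  lra.
Qed.

(* [b - a A], the curvature of a player's payoff against opponents with mean
   effort [A], as a function of the variance of the types. *)
Definition margin a b c mu v : R :=
  Num.sqrt (margin_sq (b ^+ 2 - a * (c - mu)) (a ^+ 2 * v / 4)).

(** For [a != 0] the mean effort is recovered from the margin [b - a A]. At [a = 0] the margin is
    [b] and says nothing about [A]; the value is then the mean of the dominant strategy
    [(c - t) / (2 * b)]. *)
Definition benchmark a b c mu v : R :=
  if a == 0 then (c - mu) / (2 * b) else (b - margin a b c mu v) / a.

Lemma margin_a0 b c mu v : 0 < b -> margin 0 b c mu v = b.
Proof.
move=> b0; rewrite /margin !(mul0r, expr0n, subr0, mulr0) /margin_sq mulr0 addr0.
rewrite sqrtr_sqr ger0_norm ?sqr_ge0 //.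
have -> : (b ^+ 2 + b ^+ 2) / 2 = b ^+ 2 by field.
by rewrite sqrtr_sqr ger0_norm ?ltW.
Qed.

Lemma margin_gt0 a b c mu v : 0 < b -> 0 < v -> 0 < margin a b c mu v.
Proof.
move=> b0 v0; have [->|a0] := eqVneq a 0; first by rewrite margin_a0.
rewrite sqrtr_gt0 margin_sq_gt0 // divr_gt0 // mulr_gt0 //.
by rewrite exprn_even_gt0 //=.
Qed.

Lemma marginE a b c mu v : 0 <= v ->
  margin a b c mu v ^+ 2 * (margin a b c mu v ^+ 2 - (b ^+ 2 - a * (c - mu))) =
  a ^+ 2 * v / 4.
Proof.
move=> v0; have K0 : 0 <= a ^+ 2 * v / 4.
  by rewrite divr_ge0 // mulr_ge0 // sqr_ge0.
by rewrite sqr_sqrtr ?margin_sq_ge0 // margin_sqE.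
Qed.

Lemma benchmark_margin a b c mu v : 0 < b ->
  a * benchmark a b c mu v = b - margin a b c mu v.
Proof.
move=> b0; rewrite /benchmark; have [->|a0] := eqVneq a 0.
  by rewrite margin_a0 // mul0r subrr.
by rewrite mulrC divfK.
Qed.

(* The system solved by the moments [A = E x], [B = E x^2] of an equilibrium
   [x t = (k - t) / (2 D)] with [D = b - a A] and [k = c - a B]. *)
Lemma equilibrium_moments_uniq a b c mu v A B D : 0 < b -> 0 <= v -> 0 < D ->
  D = b - a * A -> 2 * D * A = c - a * B - mu ->
  B = A ^+ 2 + v / (4 * D ^+ 2) -> A = benchmark a b c mu v.
Proof.
move=> b0 v0 D0 hD hA hB; rewrite /benchmark; have [a0|a0] := eqVneq a 0.
  move: hD hA; rewrite a0 !mul0r !subr0 => -> <-.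
  by field; rewrite gt_eqF.
have K0 : 0 <= a ^+ 2 * v / 4 by rewrite divr_ge0 // mulr_ge0 // sqr_ge0.
have Dn0 : D != 0 by rewrite gt_eqF.
suff DE : D ^+ 2 = margin_sq (b ^+ 2 - a * (c - mu)) (a ^+ 2 * v / 4).
  rewrite /margin -DE sqrtr_sqr gtr0_norm // hD opprB addrC subrK.
  by rewrite [a * A]mulrC mulfK.
apply: margin_sq_uniq => //; first by rewrite exprn_gt0.
(* Eliminating [B], and then [b] through [b = D + a * A], leaves an identity in [D], [A], [a] and
   [v]. *)
have cE : c - mu = 2 * D * A + a * A ^+ 2 + a * v / (4 * D ^+ 2).
  by rewrite hA hB; field.
rewrite cE (_ : b = D + a * A); last by rewrite hD; ring.
by field.
Qed.

(** For [a != 0], multiplying by [a] and substituting [b = D + a * A] reduces the claim to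
    [marginE]; [0 < v] makes [D] positive. *)
Lemma equilibrium_moments_ex a b c mu v : 0 < b -> 0 < v ->
  let A := benchmark a b c mu v in let D := margin a b c mu v in
  2 * D * A = c - a * (A ^+ 2 + v / (4 * D ^+ 2)) - mu.
Proof.
move=> b0 v0 A D; have D0 : 0 < D by exact: margin_gt0.
have Dn0 : D != 0 by rewrite gt_eqF.
have [a0|a0] := eqVneq a 0.
  rewrite /A /D a0 mul0r subr0 margin_a0 // /benchmark eqxx.
  by field; rewrite gt_eqF.
have hD : b = D + a * A by rewrite /A benchmark_margin // addrC subrK.
have := marginE a b c mu (ltW v0); rewrite -/D => h.
have h2 : a ^+ 2 * v / (4 * D ^+ 2) = D ^+ 2 - (b ^+ 2 - a * (c - mu)).
  apply: (mulfI (_ : D ^+ 2 != 0)); first by rewrite expf_neq0.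
  by rewrite h; field.
apply: (mulfI a0).
have -> : a * (c - a * (A ^+ 2 + v / (4 * D ^+ 2)) - mu) =
  a * (c - mu) - (a * A) ^+ 2 - a ^+ 2 * v / (4 * D ^+ 2) by field.
by rewrite h2 hD; ring.
Qed.

Lemma concave_quadraticP (D k w : R) : 0 < D ->
  (forall z, k * z - D * z ^+ 2 <= k * w - D * w ^+ 2) <-> w = k / (2 * D).
Proof.
move=> D0; have Dn0 : D != 0 by rewrite gt_eqF.
have sq z : k * z - D * z ^+ 2 =
  k ^+ 2 / (4 * D) - D * (z - k / (2 * D)) ^+ 2 by field.
split => [h|-> z].
- have := h (k / (2 * D)); rewrite !sq subrr expr0n mulr0 subr0 => hw.
  have : D * (w - k / (2 * D)) ^+ 2 <= 0 by lra.
  rewrite pmulr_rle0 // => h0; apply/eqP; rewrite -subr_eq0 -sqrf_eq0.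
  by rewrite eq_le h0 sqr_ge0.
- rewrite !sq subrr expr0n mulr0 subr0 gerBl mulr_ge0 ?sqr_ge0 //; exact: ltW.
Qed.

(** If [D <= 0], the type [k - 1], whose linear coefficient is [1], gains by deviating to
    [|x (k - 1)| + 1]. Optimality at every real type makes this type available. *)
Lemma best_response (D k : R) (x : R -> R) :
  (forall t z, (k - t) * z - D * z ^+ 2 <= (k - t) * x t - D * x t ^+ 2) ->
  0 < D.
Proof.
move=> h; rewrite ltNge; apply/negP => D0.
have := h (k - 1) (`|x (k - 1)| + 1).
set y := x (k - 1) => h1.
have : 0 <= - D * ((`|y| + 1) ^+ 2 - y ^+ 2).
  rewrite mulr_ge0 ?oppr_ge0 // subr_ge0 -[y ^+ 2]real_normK ?num_real //.
  by rewrite ler_sqr ?nnegrE ?addr_ge0 // lerDl.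
have := ler_norm y; lra.
Qed.

Lemma benchmark_le a b c mu v v' : 0 < b -> 0 <= v -> v <= v' -> 0 < a ->
  benchmark a b c mu v' <= benchmark a b c mu v.
Proof.
move=> b0 v0 vv' a0; rewrite /benchmark gt_eqF // ler_pM2r ?invr_gt0 // lerD2l lerN2.
rewrite ler_wsqrtr // margin_sq_le //.
  by rewrite divr_ge0 // mulr_ge0 // sqr_ge0.
by rewrite ler_pM2r ?invr_gt0 // ler_wpM2l // sqr_ge0.
Qed.

Lemma benchmark_ge a b c mu v v' : 0 < b -> 0 <= v -> v <= v' -> a < 0 ->
  benchmark a b c mu v <= benchmark a b c mu v'.
Proof.
move=> b0 v0 vv' a0; rewrite /benchmark lt_eqF // ler_nM2r ?invr_lt0 // lerD2l lerN2.
rewrite ler_wsqrtr // margin_sq_le //.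
  by rewrite divr_ge0 // mulr_ge0 // sqr_ge0.
by rewrite ler_pM2r ?invr_gt0 // ler_wpM2l // sqr_ge0.
Qed.

Lemma benchmark_cvg a b c mu (v : nat -> R) v0 : v @ \oo --> v0 ->
  (fun n => benchmark a b c mu (v n)) @ \oo --> benchmark a b c mu v0.
Proof.
move=> vv0; rewrite /benchmark; case: ifP => _; first exact: cvg_cst.
have cs (u : nat -> R) (l : R) : u @ \oo --> l ->
    (fun n => Num.sqrt (u n)) @ \oo --> Num.sqrt l.
  by move=> ul; apply: continuous_cvg ul; exact: sqrt_continuous.
apply: cvgM; last exact: cvg_cst.
apply: cvgB; first exact: cvg_cst.
apply: (cs); apply: cvgM; last exact: cvg_cst.
apply: cvgD; first exact: cvg_cst.
apply: (cs); apply: cvgD; first exact: cvg_cst.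
apply: cvgM; first exact: cvg_cst.
apply: cvgM; last exact: cvg_cst.
by apply: cvgM => //; exact: cvg_cst.
Qed.

End Equilibrium_algebra.

(** * Equilibria and their moments *)

Section sq_integrable.
Context d (T : measurableType d) (R : realType) (P : probability T R).
Implicit Types f g : T -> R.

Definition sq_integrable f := measurable_fun [set: T] f /\
  (\int[P]_s (f s ^+ 2)%:E < +oo)%E.

Lemma integrable_cst_prob (r : R) : P.-integrable [set: T] (EFin \o cst r).
Proof. exact: finite_measure_integrable_cst. Qed.

Lemma Rintegral_cst_prob (r : R) : \int[P]_s r = r.
Proof.
by rewrite Rintegral_cst // [X in fine X]probability_setT mulr1.
Qed.

Lemma ge0_integrable_lty f : measurable_fun [set: T] f -> (forall s, 0 <= f s) ->
  (\int[P]_s (f s)%:E < +oo)%E -> P.-integrable [set: T] (EFin \o f).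
Proof.
move=> mf f0 fi; apply/integrableP; split; first exact/measurable_EFinP.
by under eq_integral => s _ do rewrite /= ger0_norm //.
Qed.

Lemma sq_integrable_sqr f : sq_integrable f ->
  P.-integrable [set: T] (EFin \o (fun s => f s ^+ 2)).
Proof.
move=> [mf fi]; apply: ge0_integrable_lty => //.
- exact: measurable_funX.
- by move=> s; exact: sqr_ge0.
Qed.

(** Domination by [1 + f ^ 2], since [|f| <= f ^ 2 + 1 / 4]. *)
Lemma sq_integrable_integrable f : sq_integrable f ->
  P.-integrable [set: T] (EFin \o f).
Proof.
move=> hf; have h2 := sq_integrable_sqr hf.
apply: (@le_integrable _ _ _ _ _ measurableT _
  (EFin \o (fun s => 1 + f s ^+ 2))).
- by apply/measurable_EFinP; case: hf.
- move=> s _ /=; rewrite lee_fin [leRHS]ger0_norm ?addr_ge0 ?sqr_ge0 //.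
  rewrite -real_normK ?num_real //; set y := `|f s|.
  have := sqr_ge0 (y - 1 / 2).
  rewrite (_ : (y - 1 / 2) ^+ 2 = y ^+ 2 - y + 1 / 4); last by field.
  lra.
- rewrite (_ : EFin \o _ = fun s => ((cst 1%R s)%:E + (f s ^+ 2)%R%:E)%E) //.
  by apply: integrableD => //; exact: integrable_cst_prob.
Qed.

Lemma integrable_lin3 (p q r : R) f g :
  P.-integrable [set: T] (EFin \o f) -> P.-integrable [set: T] (EFin \o g) ->
  P.-integrable [set: T] (EFin \o (fun s => p + q * f s + r * g s)).
Proof.
move=> fi gi.
rewrite (_ : EFin \o _ = fun s =>
  ((cst p s)%:E + q%:E * (f s)%:E + r%:E * (g s)%:E)%E) //.
apply: integrableD => //; last exact: integrableZl.
by apply: integrableD => //; [exact: integrable_cst_prob|exact: integrableZl].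
Qed.

Lemma Rintegral_lin3 (p q r : R) f g :
  P.-integrable [set: T] (EFin \o f) -> P.-integrable [set: T] (EFin \o g) ->
  \int[P]_s (p + q * f s + r * g s) = p + q * \int[P]_s f s + r * \int[P]_s g s.
Proof.
move=> fi gi.
have qf : P.-integrable [set: T] (EFin \o (fun s => q * f s)).
  by rewrite (_ : EFin \o _ = fun s => (q%:E * (f s)%:E)%E) //; exact: integrableZl.
have rg : P.-integrable [set: T] (EFin \o (fun s => r * g s)).
  by rewrite (_ : EFin \o _ = fun s => (r%:E * (g s)%:E)%E) //; exact: integrableZl.
have pc := integrable_cst_prob p.
rewrite RintegralD //; last first.
  rewrite (_ : EFin \o _ = fun s => ((cst p s)%:E + (q * f s)%R%:E)%E) //.
  exact: integrableD.
by rewrite RintegralD // !RintegralZl // Rintegral_cst_prob.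
Qed.

Definition mean f := \int[P]_s f s.
Definition var f := \int[P]_s (f s ^+ 2) - mean f ^+ 2.

Lemma sq_integrable_affine (p q : R) f : sq_integrable f ->
  sq_integrable (fun s => p + q * f s).
Proof.
move=> hf; split.
  by apply: measurable_funD => //; apply: measurable_funM => //; case: hf.
have -> : (fun s => ((p + q * f s) ^+ 2)%:E) =
    EFin \o (fun s => p ^+ 2 + (2 * p * q) * f s + q ^+ 2 * f s ^+ 2).
  by apply/funext => s /=; congr EFin; ring.
apply: integrable_lty => //; apply: integrable_lin3.
- exact: sq_integrable_integrable.
- exact: sq_integrable_sqr.
Qed.

Lemma mean_affine (p q : R) f : sq_integrable f ->
  mean (fun s => p + q * f s) = p + q * mean f.
Proof.
move=> hf; rewrite /mean -[RHS]addr0 -(mul0r (\int[P]_s f s)).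
have fi := sq_integrable_integrable hf.
by rewrite -Rintegral_lin3 //; apply: eq_Rintegral => s _; rewrite mul0r addr0.
Qed.

Lemma Rintegral_sqr_affine (p q : R) f : sq_integrable f ->
  \int[P]_s ((p + q * f s) ^+ 2) = (p + q * mean f) ^+ 2 + q ^+ 2 * var f.
Proof.
move=> hf.
have -> : \int[P]_s ((p + q * f s) ^+ 2) =
    \int[P]_s (p ^+ 2 + (2 * p * q) * f s + q ^+ 2 * f s ^+ 2).
  by apply: eq_Rintegral => s _; ring.
rewrite Rintegral_lin3; last 2 first.
- exact: sq_integrable_integrable.
- exact: sq_integrable_sqr.
by rewrite /var /mean; ring.
Qed.

Lemma var_ge0 f : sq_integrable f -> 0 <= var f.
Proof.
move=> hf; have := Rintegral_sqr_affine (- mean f) 1 hf.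
rewrite expr1n !mul1r addNr expr0n /= add0r => <-.
by apply: Rintegral_ge0 => s _; exact: sqr_ge0.
Qed.

End sq_integrable.

(** * Equilibrium effort when the types have positive variance *)

Section benchmark_equilibrium.
Context d (T : measurableType d) (R : realType) (P : probability T R).
Variables (m : T -> R) (E : Defs.expectation R).
Hypothesis sqm : sq_integrable P m.

(* Restricted to nonnegative or integrable [h]: elsewhere the iterated integrals
   of [Epi] need not agree with the integral against a joint law. *)
Definition represents :=
  (forall h : R -> R, measurable_fun [set: R] h -> (forall t, 0 <= h t) ->
     E h = (\int[P]_s (h (m s))%:E)%E) /\
  (forall h : R -> R, measurable_fun [set: R] h ->
     P.-integrable [set: T] (EFin \o (h \o m)) ->
     E h = (\int[P]_s h (m s))%:E).

Hypothesis repE : represents.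

Lemma mean_ofE : mean_of E = mean P m.
Proof.
rewrite /mean_of (proj2 repE) //.
exact: sq_integrable_integrable.
Qed.

Lemma var_ofE : var_of E = var P m.
Proof.
rewrite /var_of -/(mean_of E) mean_ofE (proj2 repE) //.
exact: sq_integrable_sqr.
Qed.

Lemma var_of_ge0 : 0 <= var_of E.
Proof. by rewrite var_ofE var_ge0. Qed.

Lemma expected_payoff (a b c z : R) (x : R -> R) :
  measurable_fun [set: R] x -> sq_integrable P (x \o m) ->
  E (fun t => Pwin a b c z (x t)) =
  (1 / 2 + c * z - b * z ^+ 2 + (a * z ^+ 2 - c) * \int[P]_s x (m s)
    + (b - a * z) * \int[P]_s (x (m s) ^+ 2))%:E.
Proof.
move=> mx sqx.
have PE : (fun t => Pwin a b c z (x t)) = (fun t =>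
    1 / 2 + c * z - b * z ^+ 2 + (a * z ^+ 2 - c) * x t + (b - a * z) * x t ^+ 2).
  by apply/funext => t; rewrite /Pwin; ring.
have xi := sq_integrable_integrable sqx.
have x2i := sq_integrable_sqr sqx.
rewrite PE (proj2 repE).
- by rewrite (@Rintegral_lin3 _ _ _ P _ _ _ (x \o m) (fun s => x (m s) ^+ 2)).
- apply: measurable_funD; last by apply: measurable_funM => //; exact: measurable_funX.
  by apply: measurable_funD => //; exact: measurable_funM.
- exact: integrable_lin3.
Qed.

(** Best responses are forced to be affine in the type, so their first two moments solve the moment
    system, whose solution is unique. Conversely, the affine strategy built from that solution
    reproduces its moments and is therefore a best response to itself. *)
Lemma eq_effortP (a b c e : R) : 0 < b -> 0 < var P m ->
  eq_effort a b c E e <-> e = benchmark a b c (mean P m) (var P m).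
Proof.
move=> b0 v0; split.
- move=> [x [[mx x1 x2 br] eE]].
  have mm : measurable_fun [set: T] m by case: sqm.
  have sqx : sq_integrable P (x \o m).
    split; first exact: measurableT_comp.
    move: x2; rewrite (proj1 repE) //; first exact: measurable_funX.
    by move=> t; exact: sqr_ge0.
  set A := \int[P]_s x (m s); set B := \int[P]_s (x (m s) ^+ 2).
  have {}eE : e = A by rewrite eE (proj2 repE) //; exact: sq_integrable_integrable.
  set D := b - a * A; set k := c - a * B.
  have {}br t z : (k - t) * z - D * z ^+ 2 <= (k - t) * x t - D * x t ^+ 2.
    move: (br t z); rewrite !expected_payoff // -!EFinB lee_fin -/A -/B.
    by rewrite /k /D; lra.
  have D0 := best_response br.
  (* The strict concavity given by [D0] makes the maximizer of each type unique. *)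
  have xE t : x t = k / (2 * D) + (- (2 * D)^-1) * t.
    have /(concave_quadraticP _ _ D0) -> := br t.
    by field; rewrite gt_eqF.
  have AE : A = k / (2 * D) + (- (2 * D)^-1) * mean P m.
    by rewrite -mean_affine //; apply: eq_Rintegral => s _.
  have BE : B = A ^+ 2 + var P m / (4 * D ^+ 2).
    rewrite AE (_ : _ / (4 * D ^+ 2) = (- (2 * D)^-1) ^+ 2 * var P m); last first.
      by field; rewrite gt_eqF.
    by rewrite -Rintegral_sqr_affine //; apply: eq_Rintegral => s _; rewrite xE.
  rewrite eE; apply: (equilibrium_moments_uniq b0 (ltW v0) D0 _ _ BE) => //.
  by rewrite AE -/k; field; rewrite gt_eqF.
- move=> ->; set A := benchmark _ _ _ _ _.
  pose D := margin a b c (mean P m) (var P m).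
  have D0 : 0 < D by exact: margin_gt0.
  have AD := equilibrium_moments_ex a c (mean P m) b0 v0.
  rewrite -/A -/D /= in AD.
  set k := c - a * (A ^+ 2 + var P m / (4 * D ^+ 2)) in AD.
  (* The best response to opponents whose effort has mean [A] and second moment
     [A ^ 2 + var P m / (4 * D ^ 2)]; [AE] and [BE] confirm that it generates these moments. *)
  pose x t : R := k / (2 * D) + (- (2 * D)^-1) * t.
  have sqx : sq_integrable P (x \o m) by exact: sq_integrable_affine.
  have mx : measurable_fun [set: R] x.
    by apply: measurable_funD => //; exact: measurable_funM.
  have AE : \int[P]_s x (m s) = A.
    have := mean_affine (k / (2 * D)) (- (2 * D)^-1) sqm.
    rewrite /mean -/(mean P m) => ->.
    apply: (mulfI (_ : 2 * D != 0)); first by rewrite gt_eqF // mulr_gt0.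
    by rewrite AD; field; rewrite gt_eqF.
  have BE : \int[P]_s (x (m s) ^+ 2) = A ^+ 2 + var P m / (4 * D ^+ 2).
    rewrite Rintegral_sqr_affine // -mean_affine // -[mean P _]/(\int[P]_s x (m s)).
    by rewrite AE; congr (_ + _); field; rewrite gt_eqF.
  exists x; split.
    split => //.
    + rewrite (proj1 repE) //; last exact: measurableT_comp.
      have /integrableP[_] := sq_integrable_integrable sqx.
      by [].
    + rewrite (proj1 repE) //; first by case: sqx.
        exact: measurable_funX.
      by move=> t; exact: sqr_ge0.
    + move=> t z; rewrite !expected_payoff // -!EFinB lee_fin AE BE.
      have xE : x t = (k - t) / (2 * D) by rewrite /x; field; rewrite gt_eqF.
      have := (concave_quadraticP (k - t) (x t) D0).2 xE z.
      rewrite /k; set B := A ^+ 2 + _ / _.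
      have -> : D = b - a * A by rewrite benchmark_margin // opprB addrC subrK.
      by lra.
  by rewrite (proj2 repE) ?AE //; exact: sq_integrable_integrable.
Qed.

End benchmark_equilibrium.

Lemma represents_EG (R : realType) (G : probability R R) : represents G id (EG G).
Proof.
split => [h _ _|h mh hi]; first by [].
by rewrite /EG /Rintegral fineK //; exact: integrable_fin_num.
Qed.

(** * Two-point distributions *)

Section two_point.
Variable R : realType.

Definition half : {nonneg R} := (1 / 2)%:nng.

Definition two_point (x y : R) : set R -> \bar R :=
  measure_add (mscale half (dirac x)) (mscale half (dirac y)).

HB.instance Definition _ x y := Measure.on (two_point x y).

Let two_point_setT x y : two_point x y [set: R] = 1%E.
Proof.
rewrite /two_point measure_addE.
transitivity (half%:num%:E * \d_x [set: R] + half%:num%:E * \d_y [set: R])%E => //.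
rewrite !diracT !mule1 -EFinD.
by rewrite /half /=; congr EFin; field.
Qed.

HB.instance Definition _ x y :=
  Measure_isProbability.Build _ _ _ (two_point x y) (two_point_setT x y).

Lemma ge0_integral_two_point x y (f : R -> R) :
  measurable_fun [set: R] f -> (forall t, 0 <= f t) ->
  (\int[two_point x y]_t (f t)%:E)%E = ((f x + f y) / 2)%:E.
Proof.
move=> mf f0; have mEf : measurable_fun [set: R] (fun t => (f t)%:E).
  exact/measurable_EFinP.
rewrite /two_point ge0_integral_measure_add //; last by move=> t _; rewrite lee_fin.
rewrite !ge0_integral_mscale //; try by move=> t _; rewrite lee_fin.
rewrite !integral_dirac // !diracT !mul1e -!EFinM -EFinD.
by rewrite /half /=; congr EFin; field.
Qed.

Lemma sq_integrable_two_point x y : sq_integrable (two_point x y) id.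
Proof.
split; first exact: measurable_id.
by rewrite ge0_integral_two_point ?ltry // => t; exact: sqr_ge0.
Qed.

(* Read off from integrals of squares, since [ge0_integral_two_point] does not
   apply to the signed function [id]. *)
Lemma mean_two_point x y : mean (two_point x y) id = (x + y) / 2.
Proof.
have h p : ((p + x) ^+ 2 + (p + y) ^+ 2) / 2 =
    (p + mean (two_point x y) id) ^+ 2 + var (two_point x y) id.
  have := Rintegral_sqr_affine p 1 (sq_integrable_two_point x y).
  rewrite expr1n !mul1r => <-; rewrite /Rintegral ge0_integral_two_point /= ?mul1r //.
  - by apply: measurable_funX; apply: measurable_funD.
  - by move=> t; exact: sqr_ge0.
(* Subtracting the two instances cancels the second moments and leaves
   [1 + x + y = 1 + 2 * mean]. *)
by have := h 0; have := h 1; lra.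
Qed.

Lemma var_two_point x y : var (two_point x y) id = ((x - y) / 2) ^+ 2.
Proof.
rewrite /var mean_two_point /Rintegral ge0_integral_two_point //.
  by rewrite /=; field.
by move=> t; exact: sqr_ge0.
Qed.

End two_point.

(** * Degenerate types and the limit of vanishing variance *)

Section limit.
Variable R : realType.
Implicit Types a b c mu e : R.

(** Along an admissible sequence every [en n] is the benchmark at the current variance, so
    continuity in the variance gives the limit. *)
Lemma limit_effort_benchmark a b c mu : 0 < b ->
  limit_effort a b c mu (benchmark a b c mu 0).
Proof.
move=> b0 G en hG; set v := (fun n => _) => v0.
suff -> : en = fun n => benchmark a b c mu (v n) by exact: benchmark_cvg.
apply/funext => n; have [_ [G2 [mE [v_gt0 ef]]]] := hG n.
have sqG : sq_integrable (G n) id by split => //; exact: measurable_id.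
have rep := represents_EG (G n).
rewrite (var_ofE sqG rep) in v_gt0.
rewrite /v (var_ofE sqG rep) -mE (mean_ofE sqG rep).
exact/(eq_effortP sqG rep).
Qed.

(* [limit_effort] quantifies over sequences of type distributions, so its value is
   only pinned down by exhibiting one; two-point distributions do. *)
Lemma limit_effort_uniq a b c mu e : 0 < b -> limit_effort a b c mu e ->
  e = benchmark a b c mu 0.
Proof.
move=> b0 he.
pose G (n : nat) : probability R R := two_point (mu - n.+1%:R^-1) (mu + n.+1%:R^-1).
pose en n := benchmark a b c mu (var (G n) id).
have sqG n : sq_integrable (G n) id by exact: sq_integrable_two_point.
have rep n := represents_EG (G n).
have mG n : mean (G n) id = mu by rewrite mean_two_point; field.
have vG n : var (G n) id = n.+1%:R^-1 ^+ 2.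
  by rewrite var_two_point opprD addrACA subrr add0r; field.
have v0 n : 0 < var (G n) id by rewrite vG exprn_gt0 // invr_gt0.
have vE : (fun n => var_of (EG (G n))) = fun n => n.+1%:R^-1 ^+ 2.
  by apply/funext => n; rewrite (var_ofE (sqG n) (rep n)).
have vcvg : (fun n => var_of (EG (G n))) @ \oo --> (0 : R).
  rewrite vE -[0](mulr0 0).
  by apply: cvgM; exact: cvg_harmonic.
have hG n : (\int[G n]_t `|t|%:E < +oo)%E /\
    (\int[G n]_t (t ^+ 2)%R%:E < +oo)%E /\ mean_of (EG (G n)) = mu /\
    0 < var_of (EG (G n)) /\ eq_effort a b c (EG (G n)) (en n).
  split; first by have /integrableP[_] := sq_integrable_integrable (sqG n).
  split; first by case: (sqG n).
  rewrite (mean_ofE (sqG n) (rep n)) (var_ofE (sqG n) (rep n)) mG; do !split => //.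
  by apply/(eq_effortP (sqG n) (rep n)) => //; rewrite mG.
apply: (@cvg_unique _ (@Rhausdorff R) (en @ \oo)).
- exact: he hG vcvg.
- exact: limit_effort_benchmark hG vcvg.
Qed.

(** A single formula covers both the equilibrium branch and the limit branch of [bench_effort]. *)
Lemma bench_effortP d (T : measurableType d) (P : probability T R) (m : T -> R)
    (E : Defs.expectation R) a b c e :
  sq_integrable P m -> represents P m E -> 0 < b ->
  bench_effort a b c E e <-> e = benchmark a b c (mean_of E) (var_of E).
Proof.
move=> sqm rep b0; have vE := var_ofE sqm rep; have mE := mean_ofE sqm rep.
split=> [[[v0]|[v0 /(limit_effort_uniq b0)]]|eE].
- by rewrite vE in v0 *; rewrite mE => /(eq_effortP sqm rep) -> .
- by rewrite v0.
- have := var_of_ge0 sqm rep; rewrite le_eqVlt => /orP[/eqP v0|v0].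
    by right; split => //; rewrite eE -v0; exact: limit_effort_benchmark.
  by left; split => //; apply/(eq_effortP sqm rep); rewrite // -vE // -mE.
Qed.

End limit.

(** * Signals and posterior means *)

Section mixture.
Context d d' (X : measurableType d) (Y : measurableType d') (R : realType).
Variables (nu : {measure set X -> \bar R}) (w : X -> R).
Hypotheses (w0 : forall x, 0 <= w x) (mw : measurable_fun [set: X] w).
Variable k : R.-ker X ~> Y.
Local Open Scope ereal_scope.

(** Weight [1] gives the law of the signal, a clamped type gives [B |-> E (theta; s \in B)], and a
    Dirac kernel gives the measure with density [w]. The two proofs are arguments so that the
    measure structure can be attached. *)
Definition mixture of (forall x, (0 <= w x)%R) & measurable_fun [set: X] w :=
  fun B : set Y => \int[nu]_x ((w x)%:E * k x B).

Local Notation mix := (mixture w0 mw).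

Let mix0 : mix set0 = 0.
Proof. by apply: integral0_eq => x _; rewrite measure0 mule0. Qed.

Let mix_ge0 B : 0 <= mix B.
Proof. by apply: integral_ge0 => x _; rewrite mule_ge0 ?lee_fin. Qed.

Let mwk B : measurable B -> measurable_fun [set: X] (fun x => (w x)%:E * k x B).
Proof.
move=> mB; apply: emeasurable_funM; last exact: measurable_kernel.
exact/measurable_EFinP.
Qed.

Let mix_additive : semi_sigma_additive mix.
Proof.
move=> B mB tB mUB.
rewrite [X in _ --> X](_ : _ = \sum_(n <oo) mix (B n)).
  apply/cvg_closeP; split.
    by apply: is_cvg_nneseries => n _ _; exact: mix_ge0.
  by rewrite closeE.
rewrite /mixture -integral_nneseries //; last 2 first.
- by move=> n; exact: mwk.
- by move=> n x _; rewrite mule_ge0 ?lee_fin.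
apply: eq_integral => x _; rewrite nneseriesZl //; congr (_ * _).
by apply/esym/cvg_lim => //; exact/measure_semi_sigma_additive.
Qed.

HB.instance Definition _ := isMeasure.Build _ _ _ mix mix0 mix_ge0 mix_additive.

Let mint (f : Y -> \bar R) : (forall y, 0 <= f y) -> measurable_fun [set: Y] f ->
  measurable_fun [set: X] (fun x => (w x)%:E * \int[k x]_y f y).
Proof.
move=> f0 mf; apply: emeasurable_funM; first exact/measurable_EFinP.
by apply: measurable_fun_integral_kernel => // U; exact: measurable_kernel.
Qed.

Import HBNNSimple.

Let integral_mixture_nnsfun (h : {nnsfun Y >-> R}) :
  \int[mix]_y (h y)%:E = \int[nu]_x ((w x)%:E * \int[k x]_y (h y)%:E).
Proof.
have hE y : (h y)%:E = \sum_(r <- fset_set (range h))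
    (r%:E * (\1_(h @^-1` [set r]) y)%:E).
  by rewrite [in LHS](fimfunE h) -fsumEFin // fsbig_finite.
have h0 r y : 0 <= r%:E * (\1_(h @^-1` [set r]) y)%:E.
  exact: nnfun_muleindic_ge0.
have mh r : measurable_fun [set: Y] (fun y => r%:E * (\1_(h @^-1` [set r]) y)%:E).
  by apply: measurable_funeM; apply/measurable_EFinP.
have hint (mu : {measure set Y -> \bar R}) : \int[mu]_y (h y)%:E =
    \sum_(r <- fset_set (range h)) (r%:E * mu (h @^-1` [set r])).
  under eq_integral do rewrite hE.
  rewrite ge0_integral_sum //; apply: eq_bigr => r _.
  under eq_integral do rewrite -EFinM.
  rewrite (@integralZl_indic_nnsfun _ _ _ mu _ measurableT) //.
  by rewrite integral_indic // setIT.
(* For [r < 0] the preimage under the nonnegative [h] is empty, so the term is [0]. *)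
have hm0 (mu : {measure set Y -> \bar R}) r : 0 <= r%:E * mu (h @^-1` [set r]).
  have [r0|r0] := leP 0%R r; first by rewrite mule_ge0.
  by rewrite preimage_nnfun0 // measure0 mule0.
rewrite hint; under [in RHS]eq_integral => x _.
  rewrite hint ge0_sume_distrr //.
  over.
rewrite ge0_integral_sum //; last 2 first.
- move=> r; under eq_fun do rewrite muleCA.
  by apply: measurable_funeM; exact: mwk.
- by move=> r x _; rewrite mule_ge0 ?lee_fin.
apply: eq_bigr => r _.
under eq_integral do rewrite muleCA.
have [r0|r0] := leP 0%R r.
  by rewrite ge0_integralZl //; [exact: mwk|move=> x _; rewrite mule_ge0 ?lee_fin].
rewrite preimage_nnfun0 // measure0 mule0 integral0_eq // => x _.
by rewrite measure0 !mule0.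
Qed.

(** Monotone convergence along simple approximations, used for [mix], for [nu] and for each [k x],
    reduces to [integral_mixture_nnsfun]. *)
Lemma integral_mixture (f : Y -> \bar R) : (forall y, 0 <= f y) ->
  measurable_fun [set: Y] f ->
  \int[mix]_y f y = \int[nu]_x ((w x)%:E * \int[k x]_y f y).
Proof.
move=> f0 mf; pose h := nnsfun_approx measurableT mf.
have mh n : measurable_fun [set: Y] (EFin \o h n) by exact/measurable_EFinP.
have h0 n y : 0 <= (h n y)%:E by rewrite lee_fin.
have ndh y : {homo (fun n => (h n y)%:E) : m n / (m <= n)%N >-> m <= n}.
  by move=> m n mn; rewrite lee_fin; exact/lefP/nd_nnsfun_approx.
have fE y : f y = limn (fun n => (h n y)%:E).
  by apply/esym/cvg_lim => //; exact: cvg_nnsfun_approx.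
have fint (mu : {measure set Y -> \bar R}) :
    \int[mu]_y f y = limn (fun n => \int[mu]_y (h n y)%:E).
  by under eq_integral do rewrite fE; exact: monotone_convergence.
have ndint (mu : {measure set Y -> \bar R}) :
    {homo (fun n => \int[mu]_y (h n y)%:E) : m n / (m <= n)%N >-> m <= n}.
  move=> m n mn; apply: ge0_le_integral => //; [exact: mh|exact: mh|].
  by move=> y _; exact: ndh.
rewrite fint.
transitivity (\int[nu]_x limn (fun n => (w x)%:E * \int[k x]_y (h n y)%:E)).
  rewrite monotone_convergence //.
  - by congr (limn _); apply/funext => n; exact: integral_mixture_nnsfun.
  - by move=> n; apply: (mint _ (mh n)) => y; exact: h0.
  - by move=> n x _; rewrite mule_ge0 ?lee_fin // integral_ge0.
  - by move=> x _ m n mn; apply: lee_wpmul2l; [rewrite lee_fin|exact: ndint].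
apply: eq_integral => x _; rewrite fint limeMl //.
by apply: ereal_nondecreasing_is_cvgn; exact: ndint.
Qed.

End mixture.

(** * The unconditional law of a signal *)

Section law.
Context d d' (X : measurableType d) (Y : measurableType d') (R : realType).
Local Open Scope ereal_scope.

Definition law (nu : {measure set X -> \bar R}) (k : R.-ker X ~> Y) :
    {measure set Y -> \bar R} :=
  mixture nu k (fun=> ler01) (measurable_cst (1%R : R)).

Lemma lawE (nu : {measure set X -> \bar R}) (k : R.-ker X ~> Y) B :
  law nu k B = \int[nu]_x k x B.
Proof. by apply: eq_integral => x _; rewrite mul1e. Qed.

Lemma ge0_integral_law (nu : {measure set X -> \bar R}) (k : R.-ker X ~> Y)
    (f : Y -> \bar R) : (forall y, 0 <= f y) -> measurable_fun [set: Y] f ->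
  \int[law nu k]_y f y = \int[nu]_x \int[k x]_y f y.
Proof.
move=> f0 mf; rewrite integral_mixture //.
by apply: eq_integral => x _; rewrite mul1e.
Qed.

(** Positive and negative parts are handled separately; integrability under [law nu k] makes both
    inner integrals integrable over [nu], so their difference can be recombined. *)
Lemma integral_law (nu : {measure set X -> \bar R}) (k : R.-ker X ~> Y)
    (f : Y -> \bar R) : (law nu k).-integrable [set: Y] f ->
  \int[law nu k]_y f y = \int[nu]_x \int[k x]_y f y.
Proof.
move=> fi; have mf := measurable_int _ fi.
have mp := measurable_funepos mf; have mn := measurable_funeneg mf.
have part (g : Y -> \bar R) : (forall y, 0 <= g y) -> measurable_fun [set: Y] g ->
    (law nu k).-integrable [set: Y] g ->
    nu.-integrable [set: X] (fun x => \int[k x]_y g y).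
  move=> g0 mg gi; apply/integrableP; split.
    by apply: measurable_fun_integral_kernel => // U; exact: measurable_kernel.
  under eq_integral => x _ do rewrite gee0_abs ?integral_ge0 //.
  rewrite -ge0_integral_law //.
  exact: integrable_lty.
rewrite integralE !ge0_integral_law // -integralB //.
- by apply: eq_integral => x _; rewrite [RHS]integralE.
- by apply: part => //; exact: integrable_funepos.
- by apply: part => //; exact: integrable_funeneg.
Qed.

Definition signal_law (nu : probability X R) (k : R.-pker X ~> Y) : set Y -> \bar R :=
  law nu k.

HB.instance Definition _ nu k := Measure.on (signal_law nu k).

Let signal_law_setT nu k : signal_law nu k [set: Y] = 1.
Proof.
rewrite /signal_law lawE.
under eq_integral do rewrite prob_kernel.
by rewrite integral_cst // mul1e; exact: probability_setT.
Qed.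

HB.instance Definition _ nu k := Measure_isProbability.Build _ _ _
  (signal_law nu k) (signal_law_setT nu k).

End law.

Lemma represents_Epi d (S : measurableType d) (R : realType) (F : probability R R)
    (pi : R.-pker R ~> S) (m : S -> R) : measurable_fun [set: S] m ->
  represents (signal_law F pi) m (Epi F pi m).
Proof.
move=> mm; split => [h mh h0|h mh hi].
- rewrite /Epi /signal_law ge0_integral_law //.
  + by move=> s; rewrite lee_fin.
  + by apply/measurable_EFinP; exact: measurableT_comp.
- by rewrite /Epi -integral_law // /Rintegral fineK // integrable_fin_num.
Qed.

(** On [B = {f < 0}] the integral of [f] is nonnegative and equals minus that of [|f|], so [f]
    vanishes almost everywhere on [B]. *)
Lemma ae_ge0_of_integral d (T : measurableType d) (R : realType)
    (mu : {measure set T -> \bar R}) (f : T -> R) :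
  mu.-integrable [set: T] (EFin \o f) ->
  (forall B, measurable B -> 0 <= \int[mu]_(s in B) (f s)%:E)%E ->
  {ae mu, forall s, 0 <= f s}.
Proof.
move=> fi h; pose B := [set s | f s < 0].
have mf : measurable_fun [set: T] f by apply/measurable_EFinP; exact: measurable_int fi.
have mB : measurable B.
  rewrite (_ : B = f @^-1` `]-oo, 0[%classic).
    by rewrite -[X in measurable X]setTI; exact: mf.
  by apply/seteqP; split => s /=; rewrite in_itv.
have fB : mu.-integrable B (EFin \o f) by exact: integrableS fi.
have absB : (\int[mu]_(s in B) `|(EFin \o f) s|)%E = 0%E.
  apply/eqP; rewrite eq_le integral_ge0 // andbT.
  under eq_integral => s /set_mem /= sB do rewrite ltr0_norm // EFinN.
  rewrite integralN; last exact: integrable_add_def.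
  by rewrite oppe_le0 h.
have /(ae_eq_integral_abs mu mB (measurable_int _ fB)) ae0 := absB.
apply: filterS ae0 => s /= fs0; rewrite leNgt; apply/negP => sB.
by have [] := fs0 sB => s0; rewrite s0 ltxx in sB.
Qed.

(** * Truncation of types *)

Section clamp.
Variable R : realType.
Implicit Types u x : R.

Definition clamp u x := Num.max 0 (Num.min x u).

Lemma clamp_ge0 u x : 0 <= clamp u x.
Proof. by rewrite le_max lexx. Qed.

Lemma clamp_le u x : clamp u x <= Num.max 0 u.
Proof.
rewrite /clamp ge_max; apply/andP; split; first by rewrite le_max lexx.
by rewrite le_max [X in _ || X]ge_min lexx !orbT.
Qed.

Lemma clamp_id u x : 0 <= x <= u -> clamp u x = x.
Proof. by move=> /andP[x0 xu]; rewrite /clamp min_l // max_r. Qed.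

Lemma measurable_clamp u : measurable_fun [set: R] (clamp u).
Proof. by apply: measurable_maxr => //; exact: measurable_minr. Qed.

End clamp.

(** * Existence and bounds of posterior means *)

Section posterior_mean.
Context d (S : measurableType d) (R : realType).
Implicit Types (F : probability R R) (pi : R.-pker R ~> S).
Local Open Scope ereal_scope.

(* The measure [B |-> E (theta; s \in B)].  The clamp is inert for types in
   [[0, u]] and makes the measure finite without any hypothesis on [F]. *)
Definition type_law u F pi : set S -> \bar R :=
  mixture F pi (@clamp_ge0 R u) (@measurable_clamp R u).

HB.instance Definition _ u F pi := Measure.on (type_law u F pi).

(** This domination yields the finiteness of [type_law], its absolute continuity and the upper bound
    on posterior means. *)
Lemma type_law_le u F pi B : measurable B ->
  type_law u F pi B <= (Num.max 0 u)%R%:E * signal_law F pi B.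
Proof.
move=> mB; rewrite /signal_law lawE -ge0_integralZl //; last 2 first.
- exact: measurable_kernel.
- by rewrite lee_fin le_max lexx.
apply: ge0_le_integral => //.
- by move=> x _; rewrite mule_ge0 // lee_fin clamp_ge0.
- apply: emeasurable_funM; last exact: measurable_kernel.
  by apply/measurable_EFinP; exact: measurable_clamp.
- by apply: measurable_funeM; exact: measurable_kernel.
- by move=> x _; rewrite lee_wpmul2r // lee_fin clamp_le.
Qed.

Let type_law_finite u F pi : fin_num_fun (type_law u F pi).
Proof.
move=> B mB; rewrite ge0_fin_numE //.
apply: (le_lt_trans (type_law_le u F pi mB)).
rewrite lte_mul_pinfty ?lee_fin ?le_max ?lexx //.
by rewrite (le_lt_trans (probability_le1 _ mB)) ?ltry.
Qed.

HB.instance Definition _ u F pi :=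
  Measure_isFinite.Build _ _ _ (type_law u F pi) (@type_law_finite u F pi).

Lemma ge0_integral_type_law u F pi (f : S -> \bar R) :
  (forall s, 0 <= f s) -> measurable_fun [set: S] f ->
  \int[type_law u F pi]_s f s = \int[F]_th ((clamp u th)%:E * \int[pi th]_s f s).
Proof. exact: integral_mixture. Qed.

(** Trades iterated integrals for integrals against [signal_law], so that a posterior mean becomes a
    density of [type_law] with respect to [signal_law]. *)
Lemma post_meanP u F pi m : {ae F, forall th, (0 <= th <= u)%R} ->
  post_mean F pi m <->
  [/\ measurable_fun [set: S] m,
      (signal_law F pi).-integrable [set: S] (EFin \o m) &
      forall B, measurable B ->
        type_law u F pi B = \int[signal_law F pi]_(s in B) (m s)%:E].
Proof.
move=> Fu.
have lhs B : measurable B -> \int[F]_th (th%:E * pi th B) = type_law u F pi B.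
  move=> mB; apply: ae_eq_integral => //.
  - by apply: emeasurable_funM; [exact/measurable_EFinP|exact: measurable_kernel].
  - apply: emeasurable_funM; last exact: measurable_kernel.
    by apply/measurable_EFinP; exact: measurable_clamp.
  - by apply: filterS Fu => th thu _; rewrite clamp_id.
have rhs B : measurable B -> (signal_law F pi).-integrable [set: S] (EFin \o m) ->
    \int[F]_th \int[pi th]_(s in B) (m s)%:E =
    \int[signal_law F pi]_(s in B) (m s)%:E.
  move=> mB mi; rewrite [RHS]integral_mkcond integral_law.
    by apply: eq_integral => th _; rewrite integral_mkcond.
  by apply/(integrable_mkcond _ mB); exact: integrableS mi.
have abs_int : measurable_fun [set: S] m ->
    \int[F]_th \int[pi th]_s `|m s|%R%:E = \int[signal_law F pi]_s `|(EFin \o m) s|.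
  move=> mm; rewrite ge0_integral_law //.
  by apply: measurableT_comp => //; exact/measurable_EFinP.
split => [[mm mi hm]|[mm mi hm]].
- have mi' : (signal_law F pi).-integrable [set: S] (EFin \o m).
    by apply/integrableP; split; [exact/measurable_EFinP|rewrite -abs_int].
  by split => // B mB; rewrite -rhs // -hm // lhs.
- split => // [|B mB]; first by rewrite abs_int //; case/integrableP: mi.
  by rewrite lhs // rhs // hm.
Qed.

(** The posterior mean is the Radon-Nikodym derivative of [type_law] with respect to
    [signal_law]. *)
Lemma post_mean_ex u F pi : {ae F, forall th, (0 <= th <= u)%R} ->
  exists m, post_mean F pi m.
Proof.
move=> Fu.
have dom : type_law u F pi `<< signal_law F pi.
  apply/null_content_dominatesP => B mB B0; apply/eqP.
  rewrite eq_le measure_ge0 andbT (le_trans (type_law_le u F pi mB)) //.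
  by rewrite [X in _ * X](_ : _ = 0) ?mule0.
have [f [f0 ffin fi fE]] := radon_nikodym_sigma_finite dom.
exists (fine \o f); apply/(post_meanP _ _ Fu).
have fK : EFin \o (fine \o f) = f by apply/funext => s /=; rewrite fineK.
split.
- by apply: measurableT_comp => //; exact: measurable_int fi.
- by rewrite fK.
- by move=> B mB; rewrite fE //; apply: eq_integral => s _; rewrite /= fineK.
Qed.

(** Both [m] and [u - m] have nonnegative integral over every measurable set. The equational form
    lets the everywhere bounded [clamp u (m s)] replace [m s] under integrals. *)
Lemma post_mean_clamp u F pi m : (0 <= u)%R ->
  {ae F, forall th, (0 <= th <= u)%R} -> post_mean F pi m ->
  {ae signal_law F pi, forall s, m s = clamp u (m s)}.
Proof.
move=> u0 Fu /(post_meanP _ _ Fu)[mm mi hm].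
have ae0 : {ae signal_law F pi, forall s, (0 <= m s)%R}.
  by apply: ae_ge0_of_integral => // B mB; rewrite -hm.
have aeu : {ae signal_law F pi, forall s, (0 <= u - m s)%R}.
  have ci := finite_measure_integrable_cst (signal_law F pi) u measurableT.
  apply: ae_ge0_of_integral => [|B mB].
    rewrite (_ : EFin \o _ = fun s => (cst u s)%:E - (m s)%:E) //.
    exact: integrableB.
  under eq_integral do rewrite EFinB.
  rewrite integralB_EFin //; last 2 first.
  - exact: integrableS ci.
  - exact: integrableS mi.
  rewrite -hm // integral_cst // sube_ge0.
    by have := type_law_le u F pi mB; rewrite max_r.
  by rewrite fin_num_measure ?orbT.
by apply: filterS2 ae0 aeu => s m0 mu; rewrite clamp_id // m0 -subr_ge0.
Qed.

Lemma sq_integrable_post_mean u F pi m : (0 <= u)%R ->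
  {ae F, forall th, (0 <= th <= u)%R} -> post_mean F pi m ->
  sq_integrable (signal_law F pi) m.
Proof.
move=> u0 Fu pm; have [mm _ _] := pm; split => //.
apply: (@le_lt_trans _ _ (\int[signal_law F pi]_s (cst (u ^+ 2)%:E s))).
  apply: ae_ge0_le_integral => //.
  - by move=> s _; rewrite lee_fin sqr_ge0.
  - by apply/measurable_EFinP; exact: measurable_funX.
  - by move=> s _; rewrite lee_fin sqr_ge0.
  apply: filterS (post_mean_clamp u0 Fu pm) => s -> _.
  rewrite lee_fin ler_sqr ?nnegrE ?clamp_ge0 //.
  by have := clamp_le u (m s); rewrite max_r.
rewrite integral_cst //.
by rewrite [X in _ * X](_ : _ = 1) ?mule1 ?ltry //; exact: probability_setT.
Qed.

End posterior_mean.

(** * Second moments of posterior means under garbling *)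

Section Blackwell.
Context d (S : measurableType d) (R : realType).
Implicit Types (F : probability R R) (pi : R.-pker R ~> S).
Local Open Scope ereal_scope.

(** The tower property [E (theta f(s)) = E (E(theta | s) f(s))] for nonnegative [f]. *)
Lemma integral_clamp_post_mean u F pi m (f : S -> \bar R) : (0 <= u)%R ->
  {ae F, forall th, (0 <= th <= u)%R} -> post_mean F pi m ->
  (forall s, 0 <= f s) -> measurable_fun [set: S] f ->
  \int[type_law u F pi]_s f s =
  \int[signal_law F pi]_s ((clamp u (m s))%:E * f s).
Proof.
move=> u0 Fu pm f0 mf; have mE := post_mean_clamp u0 Fu pm.
have /(post_meanP _ _ Fu)[mm mi hm] := pm.
have mM : measurable_fun [set: S] (fun s => clamp u (m s)).
  exact: measurableT_comp (@measurable_clamp R u) mm.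
have mMf (g : S -> \bar R) : measurable_fun [set: S] g ->
    measurable_fun [set: S] (fun s => (clamp u (m s))%:E * g s).
  by move=> mg; apply: emeasurable_funM => //; exact/measurable_EFinP.
(* The measure with density [clamp u (m s)], written as a mixture of Dirac masses; it coincides with
   [type_law] on measurable sets. *)
pose density : {measure set S -> \bar R} :=
  mixture (signal_law F pi) (kdirac (@measurable_id _ S [set: S]))
    (fun s => clamp_ge0 u (m s)) mM.
transitivity (\int[density]_s f s).
  apply: eq_measure_integral => B mB _.
  transitivity (\int[signal_law F pi]_(s in B) (m s)%:E); first exact: hm.
  rewrite integral_mkcond.
  apply: ae_eq_integral => //.
  - apply/(measurable_restrictT _ mB)/measurable_funTS.
    exact/measurable_EFinP.
  - by apply: mMf; exact: (measurable_kernel (kdirac _)).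
  - apply: filterS mE => s sE _; rewrite /kdirac /= patchE diracE.
    by case: ifPn => sB; rewrite ?mule1 ?mule0 // {1}sE.
rewrite integral_mixture //; apply: eq_integral => s _.
by rewrite /kdirac /= integral_dirac // diracT mul1e.
Qed.

End Blackwell.

Lemma post_mean_sqr_le d d' (S : measurableType d) (S' : measurableType d')
    (R : realType) (F : probability R R) (pi : R.-pker R ~> S)
    (pi' : R.-pker R ~> S') (u : R) m m' :
  0 <= u -> {ae F, forall th, 0 <= th <= u} -> more_informative pi pi' ->
  post_mean F pi m -> post_mean F pi' m' ->
  (\int[signal_law F pi']_s (m' s ^+ 2)%:E <=
   \int[signal_law F pi]_s (m s ^+ 2)%:E)%E.
Proof.
move=> u0 Fu [g gE] pm pm'.
have [mm _ _] := pm; have [mm' _ _] := pm'.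
have mE := post_mean_clamp u0 Fu pm; have mE' := post_mean_clamp u0 Fu pm'.
pose M s := clamp u (m s); pose M' s := clamp u (m' s).
have mM : measurable_fun [set: S] M.
  exact: measurableT_comp (@measurable_clamp R u) mm.
have mM' : measurable_fun [set: S'] M'.
  exact: measurableT_comp (@measurable_clamp R u) mm'.
have M0 s : 0 <= M s by exact: clamp_ge0.
have M0' s : 0 <= M' s by exact: clamp_ge0.
have ae_sqr dT (T : measurableType dT) (P : probability T R) (f f' : T -> R) :
    measurable_fun [set: T] f -> measurable_fun [set: T] f' ->
    {ae P, forall s, f s = f' s} ->
    (\int[P]_s (f s ^+ 2)%:E = \int[P]_s (f' s ^+ 2)%:E)%E.
  move=> mf mf' ff'; apply: ae_eq_integral => //.
  - by apply/measurable_EFinP; exact: measurable_funX.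
  - by apply/measurable_EFinP; exact: measurable_funX.
  - by apply: filterS ff' => s -> _.
rewrite (ae_sqr _ _ _ _ M' mm' mM' mE') (ae_sqr _ _ _ _ M mm mM mE).
(* Integrating against the garbled signal means integrating first against [g s], then against the
   finer signal. *)
have pi'E (f : S' -> \bar R) : (forall s, (0 <= f s)%E) ->
    measurable_fun [set: S'] f -> forall th,
    (\int[pi' th]_s f s = \int[pi th]_s \int[g s]_s' f s')%E.
  move=> f0 mf th; rewrite -ge0_integral_law //.
  by apply: eq_measure_integral => B mB _; rewrite lawE gE.
have mEM' : measurable_fun [set: S'] (EFin \o M') by exact/measurable_EFinP.
have mg (f : S' -> \bar R) : (forall s, (0 <= f s)%E) ->
    measurable_fun [set: S'] f -> measurable_fun [set: S] (fun s => \int[g s]_s' f s')%E.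
  move=> f0 mf; apply: measurable_fun_integral_kernel => // U; exact: measurable_kernel.
have int_ge0 (f : S' -> \bar R) : (forall s, (0 <= f s)%E) ->
    forall s, (0 <= \int[g s]_s' f s')%E.
  by move=> f0 s; exact: integral_ge0.
have EM0' s : (0 <= (EFin \o M') s)%E by rewrite lee_fin.
have M2_0' s : (0 <= (M' s ^+ 2)%:E)%E by rewrite lee_fin sqr_ge0.
have mM2' : measurable_fun [set: S'] (fun s => (M' s ^+ 2)%:E).
  by apply/measurable_EFinP; exact: measurable_funX.
have mM2 : measurable_fun [set: S] (fun s => (M s ^+ 2)%:E).
  by apply/measurable_EFinP; exact: measurable_funX.
(* [E M' ^ 2 = E (theta M') = E (M M')]: the tower property for [pi'], the garbling under
   [type_law], then the tower property for [pi]. *)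
have lhsE : (\int[signal_law F pi']_s (M' s ^+ 2)%:E =
    \int[signal_law F pi]_s ((M s)%:E * \int[g s]_s' (M' s')%:E))%E.
  transitivity (\int[type_law u F pi']_s (EFin \o M') s)%E.
    rewrite (integral_clamp_post_mean u0 Fu pm' EM0' mEM').
    by apply: eq_integral => s _; rewrite expr2 EFinM.
  rewrite -(integral_clamp_post_mean u0 Fu pm (int_ge0 _ EM0') (mg _ EM0' mEM')).
  rewrite (ge0_integral_type_law _ _ _ EM0' mEM').
  rewrite (ge0_integral_type_law _ _ _ (int_ge0 _ EM0') (mg _ EM0' mEM')).
  by apply: eq_integral => th _; rewrite (pi'E _ EM0' mEM').
have sqE : (\int[signal_law F pi']_s (M' s ^+ 2)%:E =
    \int[signal_law F pi]_s \int[g s]_s' (M' s' ^+ 2)%:E)%E.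
  rewrite (ge0_integral_law F pi' M2_0' mM2').
  rewrite (ge0_integral_law F pi (int_ge0 _ M2_0') (mg _ M2_0' mM2')).
  by apply: eq_integral => th _; rewrite (pi'E _ M2_0' mM2').
(* AM-GM: [2 M s * M' s' <= M s ^+ 2 + M' s' ^+ 2], integrated against [g s]. *)
have amgm s : ((M s)%:E * \int[g s]_s' (M' s')%:E +
    (M s)%:E * \int[g s]_s' (M' s')%:E <=
    (M s ^+ 2)%:E + \int[g s]_s' (M' s' ^+ 2)%:E)%E.
  rewrite -ge0_integralZl //; last by rewrite lee_fin.
  rewrite -ge0_integralD //; last 4 first.
  - by move=> s' _; rewrite mule_ge0 // lee_fin.
  - by apply: measurable_funeM.
  - by move=> s' _; rewrite mule_ge0 // lee_fin.
  - by apply: measurable_funeM.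
  have -> : (M s ^+ 2)%:E = (\int[g s]_s' cst (M s ^+ 2)%:E s')%E.
    by rewrite integral_cst // prob_kernel mule1.
  rewrite -ge0_integralD //; last by move=> s' _; rewrite lee_fin sqr_ge0.
  apply: ge0_le_integral => //.
  - by move=> s' _; rewrite adde_ge0 // mule_ge0 // lee_fin.
  - by apply: emeasurable_funD; exact: measurable_funeM.
  - exact: emeasurable_funD.
  - move=> s' _; rewrite -!EFinM -!EFinD lee_fin.
    by have := sqr_ge0 (M s - M' s'); rewrite sqrrB mulr2n; lra.
  - by move=> s' _; rewrite lee_fin.
have fin' : (\int[signal_law F pi']_s (M' s ^+ 2)%:E \is a fin_num)%E.
  rewrite -(ae_sqr _ _ _ _ M' mm' mM' mE').
  have := sq_integrable_sqr (sq_integrable_post_mean u0 Fu pm').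
  exact: integrable_fin_num.
have m1 : measurable_fun [set: S] (fun s => (M s)%:E * \int[g s]_s' (M' s')%:E)%E.
  by apply: emeasurable_funM; [exact/measurable_EFinP|exact: mg].
have p1 t : (0 <= (M t)%:E * \int[g t]_s' (M' s')%:E)%E.
  by apply: mule_ge0; [rewrite lee_fin; exact: M0|exact: (int_ge0 _ EM0')].
(* The finite [E M' ^ 2] is added to both sides: the left becomes twice the cross term, the right
   the bound of [amgm]. *)
rewrite -(@leeD2rE _ _ _ _ fin') [X in (X + X <= _)%E]lhsE -ge0_integralD //.
rewrite sqE -ge0_integralD //.
- apply: ge0_le_integral => //.
  + by move=> s _; rewrite adde_ge0.
  + exact: emeasurable_funD.
  + by apply: emeasurable_funD => //; exact: mg.
- by move=> s _; rewrite lee_fin sqr_ge0.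
- by move=> s _; exact: integral_ge0.
- exact: mg.
Qed.

(** * Extremes of the Blackwell order *)

Section more_informative.
Context d (S : measurableType d) (R : realType).
Implicit Types pi : R.-pker R ~> S.

Lemma more_informative_refl pi : more_informative pi pi.
Proof.
exists (kdirac (@measurable_id _ S [set: S])) => th B mB.
transitivity (\int[pi th]_s (\1_B s)%:E)%E; last by [].
by rewrite integral_indic // setIT.
Qed.

Lemma more_informative_no_disclosure pi : more_informative pi (no_disclosure R).
Proof.
exists (kdirac (@measurable_cst _ _ S unit [set: S] tt)) => th B mB.
transitivity (\int[pi th]_s (cst (\d_tt B : \bar R) s))%E; last by [].
by rewrite integral_cst // prob_kernel mule1.
Qed.

Lemma full_disclosure_more_informative pi : more_informative (full_disclosure R) pi.
Proof.
(* The fully revealing signal is the type itself, so [pi] serves as its own garbling kernel. *)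
exists pi => th B mB; rewrite /full_disclosure /kdirac /= integral_dirac //.
  by rewrite diracT mul1e.
exact: measurable_kernel.
Qed.

End more_informative.

(** * Effort as a function of the information structure *)

Section benchmark_of_information.
Variables (R : realType) (F : probability R R) (u M1 : R).
Hypotheses (u0 : 0 <= u) (Fu : {ae F, forall th, 0 <= th <= u}).
Hypothesis FM1 : (\int[F]_th th%:E)%E = M1%:E.

(** The defining identity of a posterior mean, tested on the whole signal space. *)
Lemma mean_of_Epi d (S : measurableType d) (pi : R.-pker R ~> S) m :
  post_mean F pi m -> mean_of (Epi F pi m) = M1.
Proof.
move=> [_ _ /(_ _ measurableT) h]; rewrite /mean_of /Epi -h.
under eq_integral do rewrite prob_kernel mule1.
by rewrite FM1.
Qed.

(** All posterior means share the mean [M1], so comparing variances amounts to comparing second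
    moments. *)
Lemma var_of_Epi d (S : measurableType d) (pi : R.-pker R ~> S) m :
  post_mean F pi m ->
  (var_of (Epi F pi m) + M1 ^+ 2)%:E =
  (\int[signal_law F pi]_s (m s ^+ 2)%:E)%E.
Proof.
move=> pm; have sqm := sq_integrable_post_mean u0 Fu pm.
have rep : represents (signal_law F pi) m (Epi F pi m).
  by apply: represents_Epi; case: pm.
rewrite -(mean_of_Epi pm) (var_ofE sqm rep) (mean_ofE sqm rep) /var subrK.
by rewrite /Rintegral fineK //; exact: integrable_fin_num (sq_integrable_sqr sqm).
Qed.

Lemma var_of_Epi_le d d' (S : measurableType d) (S' : measurableType d')
    (pi : R.-pker R ~> S) (pi' : R.-pker R ~> S') m m' :
  more_informative pi pi' -> post_mean F pi m -> post_mean F pi' m' ->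
  var_of (Epi F pi' m') <= var_of (Epi F pi m).
Proof.
move=> inf pm pm'; rewrite -(lerD2r (M1 ^+ 2)) -lee_fin !var_of_Epi //.
exact: (post_mean_sqr_le u0 Fu inf pm pm').
Qed.

Lemma var_of_Epi_ge0 d (S : measurableType d) (pi : R.-pker R ~> S) m :
  post_mean F pi m -> 0 <= var_of (Epi F pi m).
Proof.
move=> pm; apply: (@var_of_ge0 _ _ _ (signal_law F pi) m).
- exact: sq_integrable_post_mean u0 Fu pm.
- by apply: represents_Epi; case: pm.
Qed.

Lemma bench_effort_Epi d (S : measurableType d) (pi : R.-pker R ~> S) m a b c e :
  0 < b -> post_mean F pi m ->
  bench_effort a b c (Epi F pi m) e <->
  e = benchmark a b c M1 (var_of (Epi F pi m)).
Proof.
move=> b0 pm; rewrite -(mean_of_Epi pm).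
apply: (@bench_effortP _ _ _ (signal_law F pi) m) => //.
- exact: sq_integrable_post_mean u0 Fu pm.
- by apply: represents_Epi; case: pm.
Qed.

Lemma effort_ex d (S : measurableType d) (pi : R.-pker R ~> S) a b c :
  0 < b -> exists e, effort a b c F pi e.
Proof.
move=> b0; have [m pm] := post_mean_ex pi Fu.
exists (benchmark a b c M1 (var_of (Epi F pi m))); split; first by exists m.
move=> m' pm'; apply/(bench_effort_Epi a c _ b0 pm'); congr benchmark.
(* Two versions of the posterior mean have equal variance, by comparing [pi] with itself in both
   directions. *)
by apply/eqP; rewrite eq_le !var_of_Epi_le //; exact: more_informative_refl.
Qed.

Lemma effort_benchmark d (S : measurableType d) (pi : R.-pker R ~> S) a b c e :
  0 < b -> effort a b c F pi e -> exists2 m, post_mean F pi m &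
    e = benchmark a b c M1 (var_of (Epi F pi m)).
Proof.
by move=> b0 [[m pm] /(_ m pm) /(bench_effort_Epi _ _ _ b0 pm) ->]; exists m.
Qed.

Lemma effort_mono d d' (S : measurableType d) (S' : measurableType d')
    (pi : R.-pker R ~> S) (pi' : R.-pker R ~> S') a b c e e' :
  0 < b -> more_informative pi pi' ->
  effort a b c F pi e -> effort a b c F pi' e' ->
  (0 < a -> e <= e') /\ (a < 0 -> e' <= e).
Proof.
move=> b0 inf /(effort_benchmark b0)[m pm ->] /(effort_benchmark b0)[m' pm' ->].
have v0 := var_of_Epi_ge0 pm'; have vv := var_of_Epi_le inf pm pm'.
by split; [exact: benchmark_le|exact: benchmark_ge].
Qed.

End benchmark_of_information.

Lemma has_support_ae (R : realType) (F : probability R R) (al be : R) :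
  has_support F al be -> {ae F, forall th, al <= th <= be}.
Proof.
move=> [F1 _]; exists (~` `[al, be]%classic); split.
- by apply: measurableC; exact: measurable_itv.
- by rewrite probability_setC // F1 subee.
- by move=> th /=; rewrite in_itv.
Qed.

Theorem theorem5 (R : realType) (a b c al be M1 : R) (F : probability R R)
  (hb : 0 < b) (hc : 0 < c) (hal : 0 < al) (hbe : be < c)
  (hF : has_support F al be) (hM1 : (\int[F]_th th%:E)%E = M1%:E) :
  (* the benchmark effort cal E(pi) is well defined for every pi in cal S *)
  (forall d (S : measurableType d) (pi : R.-pker R ~> S),
      exists e, effort a b c F pi e) /\
  (* cal E(pi) depends on pi only through Var(hat theta_pi) *)
  (forall d d' (S : measurableType d) (S' : measurableType d')
          (pi : R.-pker R ~> S) (pi' : R.-pker R ~> S') (v e e' : R),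
      post_var F pi v -> post_var F pi' v ->
      effort a b c F pi e -> effort a b c F pi' e' -> e = e') /\
  (* optimal design over cal S *)
  (0 < a -> forall d (S : measurableType d) (pi : R.-pker R ~> S) (e e0 : R),
      effort a b c F pi e -> effort a b c F (no_disclosure R) e0 -> e <= e0) /\
  (a < 0 -> forall d (S : measurableType d) (pi : R.-pker R ~> S) (e e1 : R),
      effort a b c F pi e -> effort a b c F (full_disclosure R) e1 -> e <= e1) /\
  (a = 0 -> forall d d' (S : measurableType d) (S' : measurableType d')
          (pi : R.-pker R ~> S) (pi' : R.-pker R ~> S') (e e' : R),
      effort a b c F pi e -> effort a b c F pi' e' -> e = e') /\
  (* Blackwell comparison *)
  (forall d d' (S : measurableType d) (S' : measurableType d')
          (pi : R.-pker R ~> S) (pi' : R.-pker R ~> S') (e e' : R),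
      more_informative pi pi' ->
      effort a b c F pi e -> effort a b c F pi' e' ->
      (0 < a -> e <= e') /\ (a < 0 -> e' <= e)).
Proof.
(* The maximum with [0] gives an upper bound for the types that is nonnegative by construction. *)
have u0 : 0 <= Num.max 0 be by rewrite le_max lexx.
have Fu : {ae F, forall th, 0 <= th <= Num.max 0 be}.
  apply: filterS (has_support_ae hF) => th /andP[alth thbe].
  by rewrite (le_trans (ltW hal) alth) le_max thbe orbT.
split; first by move=> d S pi; exact: (effort_ex u0 Fu hM1).
split.
  move=> d d' S S' pi pi' v e e' hv hv' /(effort_benchmark u0 Fu hM1 hb)[m pm ->].
  by move=> /(effort_benchmark u0 Fu hM1 hb)[m' pm' ->]; rewrite hv // hv'.
split.
  move=> a0 d S pi e e0 he he0.
  have := effort_mono u0 Fu hM1 hb (more_informative_no_disclosure pi) he he0.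
  by case=> /(_ a0).
split.
  move=> a0 d S pi e e1 he he1.
  have := effort_mono u0 Fu hM1 hb (full_disclosure_more_informative pi) he1 he.
  by case=> _ /(_ a0).
split; last by move=> d d' S S' pi pi' e e'; exact: (effort_mono u0 Fu hM1).
move=> a0 d d' S S' pi pi' e e' /(effort_benchmark u0 Fu hM1 hb)[m _ ->].
move=> /(effort_benchmark u0 Fu hM1 hb)[m' _ ->].
(* At [a = 0] both efforts equal [(c - M1) / (2 * b)], whatever the variance. *)
by rewrite /benchmark a0 eqxx.
Qed.
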